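(* With $Z^k_t$ and $\mathrm{OPT}$ defined as in the context, $$\mathrm{OPT}=\sum_{k=1}^{\infty}E\Big[\max_{t=1,\ldots,T}Z^k_t\Big].$$
   Context: Let $T,D\ge 1$ be integers. $\mathbf Y=(Y_1,\ldots,Y_T)$ is an arbitrary (possibly non-Markovian) discrete-time stochastic process, each $Y_t$ being a random vector in $\mathbb R^D$; $Y_{[t]}=(Y_1,\ldots,Y_t)$. $\mathcal F=(\mathcal F_t)_{t=1}^T$ is the natural filtration of $\mathbf Y$. For each $t$, $g_t:\mathbb R^{D\times t}\to\mathbb R$ is measurable and $Z_t=g_t(Y_{[t]})$ is the reward for stopping at $t$. It is assumed that every $Z_t$ is integrable and non-negative. $\mathcal T$ is the set of stopping times adapted to $\mathcal F$ with values in $\{1,\ldots,T\}$, and $\mathrm{OPT}=\sup_{\tau\in\mathcal T}E[Z_\tau]$, assumed strictly positive. Define $Z^1_t=Z_t$ and, for $k\ge1$ and $t\in\{1,\ldots,T\}$, $Z^{k+1}_t=Z^k_t-E\big[\max_{i=1,\ldots,T}Z^k_i\,\big|\,\mathcal F_t\big]$. *)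

(* Defs.v *)
From HB Require Import structures.
From mathcomp Require Import all_boot all_order all_algebra.
From mathcomp Require Import all_classical all_reals all_analysis.
From mathcomp Require Import measurable_realfun random_variable.

Set Implicit Arguments.
Unset Strict Implicit.
Unset Printing Implicit Defensive.

Import Order.TTheory GRing.Theory Num.Theory.
Import numFieldNormedType.Exports.

Local Open Scope classical_set_scope.
Local Open Scope ring_scope.

(* Time is indexed by nat and runs through 1, ..., T; processes are arbitrary
   (and never looked at) outside this range. *)

(* Y_[t] = (Y_1, ..., Y_t); the nested tuple type carries the product Borel
   sigma-algebra of R^(D x t). *)
Definition history (Omega E : Type) (Y : nat -> Omega -> E) (t : nat)
  (w : Omega) : t.-tuple E := [tuple Y i.+1 w | i < t].

Definition natural_filtration d d' (Omega : measurableType d)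
    (E : measurableType d') (Y : nat -> Omega -> E) (t : nat)
    : set (set Omega) :=
  g_sigma_preimage (fun i : 'I_t => Y i.+1).

Definition stopping_time (Omega : Type) (T : nat)
    (F : nat -> set (set Omega)) (tau : Omega -> nat) : Prop :=
  (forall w, (1 <= tau w <= T)%N) /\
  (forall t, (1 <= t <= T)%N -> F t [set w | (tau w <= t)%N]).

Definition opt_value d (Omega : measurableType d) (R : realType)
    (P : probability Omega R) (T : nat) (F : nat -> set (set Omega))
    (Z : nat -> Omega -> R) : \bar R :=
  ereal_sup [set ('E_P[fun w => Z (tau w) w])%E | tau in stopping_time T F].

(* C is a version of E[X | G], for X integrable and G a sub-sigma-algebra. *)
Definition is_cond_exp d (Omega : measurableType d) (R : realType)
    (P : probability Omega R) (G : set (set Omega)) (X C : Omega -> R) : Prop :=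
  [/\ (forall B : set R, measurable B -> G (C @^-1` B)),
      P.-integrable [set: Omega] (EFin \o C) &
      forall A, G A ->
        (\int[P]_(w in A) (C w)%:E = \int[P]_(w in A) (X w)%:E)%E].

(* The value at time 1 is a neutral starting point, as T >= 1. *)
Definition path_max (Omega : Type) (R : realType) (T : nat)
    (X : nat -> Omega -> R) (w : Omega) : R :=
  \big[Num.max/X 1%N w]_(1 <= t < T.+1) X t w.

(* Zs k t is Z^k_t. Conditional expectations are defined only up to null sets:
   any choice of versions is allowed. *)
Definition iterated_process d (Omega : measurableType d) (R : realType)
    (P : probability Omega R) (T : nat) (F : nat -> set (set Omega))
    (Z : nat -> Omega -> R) (Zs : nat -> nat -> Omega -> R) : Prop :=
  (forall t, (1 <= t <= T)%N -> Zs 1%N t = Z t) /\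
  (forall k t, (1 <= k)%N -> (1 <= t <= T)%N ->
     exists2 C : Omega -> R, is_cond_exp P (F t) (path_max T (Zs k)) C &
       Zs k.+1 t = Zs k t \- C).

Lemma is_cond_exp_exists d (Omega : measurableType d) (R : realType)
    (P : probability Omega R) (G : set (set Omega)) (X : Omega -> R) :
  sigma_algebra setT G -> G `<=` measurable ->
  P.-integrable [set: Omega] (EFin \o X) -> exists C, is_cond_exp P G X C.
Proof.
move=> sG Gm iX.
have GE : @measurable _ (g_sigma_algebraType G) = G by exact: sigma_algebra_id.
pose phi : Omega -> g_sigma_algebraType G := id.
have mphi : measurable_fun setT phi.
  by move=> _ B mB; rewrite setTI preimage_id; apply: Gm; rewrite -GE.
pose f : {mfun Omega >-> g_sigma_algebraType G} :=
  HB.pack phi (isMeasurableFun.Build _ _ _ _ _ mphi).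
pose mu : probability _ R := distribution P f.
pose ind : {charge set Omega -> \bar R} := induced_charge iX.
pose nu0 : set (g_sigma_algebraType G) -> \bar R := ind.
have nu_0 : nu0 set0 = 0%E by exact: charge0.
have nu_fin A : measurable A -> nu0 A \is a fin_num.
  by move=> mA; apply: (@fin_num_measure _ _ _ ind); apply: Gm; rewrite -GE.
have nu_sigma : semi_sigma_additive nu0.
  move=> A mA tA mUA; apply: (@charge_semi_sigma_additive _ _ _ ind) => //.
    by move=> n; apply: Gm; rewrite -GE; exact: mA.
  by apply: Gm; rewrite -GE.
pose nu : {charge set (g_sigma_algebraType G) -> \bar R} :=
  HB.pack nu0 (isCharge.Build _ _ _ nu0 nu_0 nu_fin nu_sigma).
have numu : nu `<< mu.
  apply/null_content_dominatesP => A mA muA0.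
  have mA' : measurable (A : set Omega) by apply: Gm; rewrite -GE.
  have mX : measurable_fun (A : set Omega) (EFin \o X : _ -> \bar R).
    by apply: measurable_funTS; exact: measurable_int iX.
  exact: (null_set_integral mA' mX muA0).
pose h := Radon_Nikodym nu mu.
have hfin x : h x \is a fin_num by exact: Radon_Nikodym_fin_num.
have ih : mu.-integrable setT h by exact: Radon_Nikodym_integrable.
have mh : measurable_fun setT h by exact: measurable_int ih.
have ihP : P.-integrable setT (h \o f).
  apply/integrableP; split; first exact: (measurableT_comp mh).
  have /integrableP[_] := ih.
  rewrite /mu /distribution ge0_integral_pushforward//.
  exact: measurableT_comp.
have hE : EFin \o (fine \o h : Omega -> R) = h \o f.
  by apply/funext => w /=; rewrite fineK.
exists (fine \o h); split.
- move=> B mB; rewrite -GE -[X in measurable X]setTI.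
  by apply: (measurableT_comp _ mh) => //; exact: fine_measurable.
- by rewrite hE.
- move=> A GA.
  have mA : measurable (A : set (g_sigma_algebraType G)) by rewrite GE.
  have := Radon_Nikodym_integral numu mA; rewrite -/h.
  rewrite /mu /distribution integral_pushforward//; last first.
    by apply: (integrableS _ _ _ ihP) => //; exact: Gm.
  move=> nuE; rewrite [RHS](_ : _ = nu A)// nuE.
  by apply: eq_integral => w _ /=; rewrite fineK.
Qed.

(* Main.v *)
Require Import Defs.
From mathcomp Require Import all_boot all_order all_algebra.
From mathcomp Require Import all_classical all_reals all_analysis.
From mathcomp Require Import measurable_realfun random_variable.

Set Implicit Arguments.
Unset Strict Implicit.
Unset Printing Implicit Defensive.

Import Order.TTheory GRing.Theory Num.Theory.
Import numFieldNormedType.Exports.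

Local Open Scope classical_set_scope.
Local Open Scope ring_scope.

(** Write M_k for the path maximum of Z^k. For a stopping time tau, the
    martingale t |-> E[M_k | F_t] stopped at tau has mean E[M_k], so
    E[Z^k_tau] = E[M_k] + E[Z^{k+1}_tau], and by induction
      E[Z_tau] = E[M_1] + ... + E[M_n] + E[Z^{n+1}_tau]
    ([expectation_stopped_expansion]). The theorem amounts to the claim that
    the remainder E[Z^{n+1}_tau] is nonpositive for every tau and vanishes in
    the limit for one of them.

    After one step the processes have a sign and are monotone. As M_k dominates
    the F_t-measurable variable Z^k_t, so does E[M_k | F_t], hence
    Z^{k+1}_t <= 0 almost surely. Consequently M_k <= 0 for k >= 2, and from
    then on subtracting E[M_k | F_t] makes Z^k_t increase with k. This gives
    the upper bound for every tau: the remainder is nonpositive, so E[Z_tau] is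
    at most each partial sum of length at least one
    ([expectation_stopped_iterated_le]).

    For the converse, consider the last time T. There M_k is F_T-measurable, so
    Z^{k+1}_T = Z^k_T - M_k: if all Z^k_t, t = 1, ..., T, remained below some
    -e for every k >= 2, each step would raise Z^k_T by at least e, in
    contradiction with Z^k_T <= 0 ([exists_time_sup_ge0]). So almost surely some
    time t satisfies sup_k Z^k_t >= 0, that is, Z^k_t increases to 0. The first
    such time is a stopping time tau, because the event depends on F_t only, and
    dominated convergence yields E[Z^k_tau] --> 0
    ([exists_optimal_stopping_time]). Therefore the partial sums converge to
    E[Z_tau], which dominates every other E[Z_tau'] and is thus the optimal
    value. *)

(** * Conditional expectations and sub-sigma-algebras *)

Section sub_sigma_algebra.
Context d (Omega : measurableType d) (R : realType) (P : probability Omega R).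
Implicit Types (G : set (set Omega)) (U V X : Omega -> R).

Definition measurable_wrt G X :=
  forall B : set R, measurable B -> G (X @^-1` B).

Lemma measurable_sub_sigma_algebraE G : sigma_algebra setT G ->
  @measurable _ (g_sigma_algebraType G) = G.
Proof. exact: sigma_algebra_id. Qed.

(** The right-hand side is measurability for a measurable structure on the
    sample space, which brings in the closure properties of measurable
    functions. *)
Lemma measurable_wrtE G X : sigma_algebra setT G ->
  measurable_wrt G X <->
  measurable_fun setT (X : g_sigma_algebraType G -> R).
Proof.
move=> sG; have GE := measurable_sub_sigma_algebraE sG.
split=> [mX _ B mB|mX B mB]; first by rewrite setTI GE; exact: mX.
by rewrite -GE -[X in measurable X]setTI; exact: mX.
Qed.

Lemma measurable_wrtB G U V : sigma_algebra setT G ->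
  measurable_wrt G U -> measurable_wrt G V -> measurable_wrt G (U \- V).
Proof.
by move=> sG /(measurable_wrtE _ sG) ? /(measurable_wrtE _ sG) ?;
  apply/measurable_wrtE => //; exact: measurable_funB.
Qed.

Lemma measurable_wrt_max G U V : sigma_algebra setT G ->
  measurable_wrt G U -> measurable_wrt G V -> measurable_wrt G (U \max V).
Proof.
by move=> sG /(measurable_wrtE _ sG) ? /(measurable_wrtE _ sG) ?;
  apply/measurable_wrtE => //; exact: measurable_maxr.
Qed.

Lemma measurable_wrt_ltset G U V : sigma_algebra setT G ->
  measurable_wrt G U -> measurable_wrt G V -> G [set w | V w < U w].
Proof.
move=> sG mU mV.
rewrite (_ : mkset _ = (U \- V) @^-1` `]0, +oo[); last first.
  by apply/seteqP; split=> w /=; rewrite in_itv/= andbT subr_gt0.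
exact: measurable_wrtB.
Qed.

(** Test the integral inequality on the event V < U, which belongs to G: there
    the positive function U - V has a nonpositive integral, so the event is
    negligible. *)
Lemma ae_le_of_integral_le G U V :
  sigma_algebra setT G -> G `<=` measurable ->
  measurable_wrt G U -> measurable_wrt G V ->
  P.-integrable setT (EFin \o U) -> P.-integrable setT (EFin \o V) ->
  (forall A, G A ->
     (\int[P]_(w in A) (U w)%:E <= \int[P]_(w in A) (V w)%:E)%E) ->
  {ae P, forall w, U w <= V w}.
Proof.
move=> sG Gm mU mV iU iV UV.
pose A := [set w | V w < U w].
have GA : G A by exact: measurable_wrt_ltset.
have mA : measurable A by exact: Gm.
have iUA : P.-integrable A (EFin \o U) by exact: integrableS iU.
have iVA : P.-integrable A (EFin \o V) by exact: integrableS iV.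
have int0 : (\int[P]_(w in A) `|(EFin \o U) w - (EFin \o V) w| = 0)%E.
  apply/eqP; rewrite eq_le integral_ge0// andbT.
  rewrite (eq_integral (fun w => (EFin \o U) w - (EFin \o V) w)%E); last first.
    move=> w /set_mem /= Aw; rewrite -EFinB /= ger0_norm//.
    by rewrite subr_ge0 ltW.
  rewrite integralB// sube_le0; exact: UV.
move/ae_eq_integral_abs : int0 => /(_ mA).
have mUV : measurable_fun A (fun w => (EFin \o U) w - (EFin \o V) w)%E.
  exact/measurable_int/(integrableB mA iUA iVA).
move=> /(_ mUV); apply: filterS => w /= Aw0.
rewrite leNgt; apply/negP => Aw.
have := Aw0 Aw; rewrite -EFinB => -[/eqP].
by rewrite subr_eq0 gt_eqF.
Qed.

Lemma ae_le_integral A U V : measurable A ->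
  P.-integrable setT (EFin \o U) -> P.-integrable setT (EFin \o V) ->
  {ae P, forall w, U w <= V w} ->
  (\int[P]_(w in A) (U w)%:E <= \int[P]_(w in A) (V w)%:E)%E.
Proof.
move=> mA iU iV [N [mN N0 UVN]].
rewrite (negligible_integral mN mA _ N0); last exact: integrableS iU.
rewrite [leRHS](negligible_integral mN mA _ N0); last exact: integrableS iV.
have mAN : measurable (A `\` N) by exact: measurableD.
apply: le_integral => //; [exact: integrableS iU|exact: integrableS iV|].
move=> w /set_mem[_ Nw]; rewrite lee_fin; apply: contrapT => UVw.
exact/Nw/UVN.
Qed.

Lemma cond_exp_ge G X C U : sigma_algebra setT G -> G `<=` measurable ->
  is_cond_exp P G X C -> P.-integrable setT (EFin \o X) ->
  measurable_wrt G U -> P.-integrable setT (EFin \o U) ->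
  {ae P, forall w, U w <= X w} -> {ae P, forall w, U w <= C w}.
Proof.
move=> sG Gm [mC iC CX] iX mU iU UX.
apply: (ae_le_of_integral_le sG) => // A GA; rewrite CX//.
exact: ae_le_integral (Gm _ GA) _ _ UX.
Qed.

Lemma cond_exp_le G X C U : sigma_algebra setT G -> G `<=` measurable ->
  is_cond_exp P G X C -> P.-integrable setT (EFin \o X) ->
  measurable_wrt G U -> P.-integrable setT (EFin \o U) ->
  {ae P, forall w, X w <= U w} -> {ae P, forall w, C w <= U w}.
Proof.
move=> sG Gm [mC iC CX] iX mU iU XU.
apply: (ae_le_of_integral_le sG) => // A GA; rewrite CX//.
exact: ae_le_integral (Gm _ GA) _ _ XU.
Qed.

End sub_sigma_algebra.

(** * The maximum along a path *)

Section path_max.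
Context (Omega : Type) (R : realType) (T : nat).
Implicit Type X : nat -> Omega -> R.

Lemma path_max_ge X t w : (1 <= t <= T)%N -> X t w <= path_max T X w.
Proof. by move=> tT; apply: le_bigmax_seq => //; rewrite mem_index_iota. Qed.

Lemma path_max_le X c w : (1 <= T)%N ->
  (forall t, (1 <= t <= T)%N -> X t w <= c) -> path_max T X w <= c.
Proof.
move=> T1 Xc; rewrite /path_max big_nat; apply: bigmax_le => [|t tT].
  by apply: Xc; rewrite leqnn.
exact: Xc.
Qed.

(** Used with K being integrability, or measurability with respect to a given
    sigma-algebra. *)
Lemma path_max_closed X (K : (Omega -> R) -> Prop) : (1 <= T)%N ->
  (forall U V, K U -> K V -> K (U \max V)) ->
  (forall t, (1 <= t <= T)%N -> K (X t)) -> K (path_max T X).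
Proof.
move=> T1 Kmax KX; rewrite /path_max.
have : forall t, t \in index_iota 1 T.+1 -> K (X t).
  by move=> t; rewrite mem_index_iota; exact: KX.
elim: (index_iota 1 T.+1) => [_|t s IHs Ks].
  rewrite [X in K X](_ : _ = X 1%N); first by apply: KX; rewrite leqnn.
  by apply/funext => w; rewrite big_nil.
rewrite [X in K X](_ : _ =
    X t \max (fun w => \big[Num.max/X 1%N w]_(i <- s) X i w)); last first.
  by apply/funext => w; rewrite big_cons.
apply: Kmax; first by apply: Ks; rewrite mem_head.
by apply: IHs => i si; apply: Ks; rewrite inE si orbT.
Qed.

End path_max.

Lemma integrable_maxr d (Omega : measurableType d) (R : realType)
    (P : probability Omega R) (U V : Omega -> R) :
  P.-integrable setT (EFin \o U) -> P.-integrable setT (EFin \o V) ->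
  P.-integrable setT (EFin \o (U \max V)).
Proof.
move=> iU iV.
have mE (X : Omega -> R) :
    P.-integrable setT (EFin \o X) -> measurable_fun setT X.
  by move=> iX; apply/measurable_EFinP; exact: measurable_int iX.
apply: (le_integrable measurableT _ _
  (integrableD measurableT (integrable_norm iU) (integrable_norm iV))).
  by apply/measurable_EFinP; apply: measurable_maxr; exact: mE.
move=> w _ /=; rewrite lee_fin [leRHS]ger0_norm ?addr_ge0//.
by rewrite /Num.max; case: ifP => _; rewrite ?lerDl ?lerDr normr_ge0.
Qed.

(** * Processes stopped at a random time *)

Section stopped.
Context d (Omega : measurableType d) (R : realType) (P : probability Omega R).
Variables (T : nat) (tau : Omega -> nat).
Hypothesis tauT : forall w, (1 <= tau w <= T)%N.
Hypothesis mtau : forall t, (1 <= t <= T)%N -> measurable [set w | tau w = t].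
Implicit Type f : nat -> Omega -> R.

Lemma stoppedE f : (EFin \o (fun w => f (tau w) w)) =
  (fun w => \sum_(i < T) ((EFin \o f i.+1) \_ [set w | tau w = i.+1]) w)%E.
Proof.
apply/funext => w /=; have /andP[tau1 tau2] := tauT w.
have tauP : ((tau w).-1 < T)%N by rewrite prednK.
rewrite (bigD1 (Ordinal tauP))//= patchE prednK// mem_set// big1 ?adde0//.
move=> i itau; rewrite patchE memNset// => /= tauE.
by move/eqP: itau; apply; apply/val_inj => /=; rewrite tauE.
Qed.

Let integrable_piece f (i : 'I_T) :
  (forall t, (1 <= t <= T)%N -> P.-integrable setT (EFin \o f t)) ->
  P.-integrable setT ((EFin \o f i.+1) \_ [set w | tau w = i.+1]).
Proof.
move=> fi; have mi := mtau (ltn_ord i : (1 <= i.+1 <= T)%N).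
apply: (iffLR (integrable_mkcond _ mi)).
apply: (integrableS measurableT mi (@subsetT _ _)).
exact: (fi _ (ltn_ord i : (1 <= i.+1 <= T)%N)).
Qed.

Lemma integrable_stopped f :
  (forall t, (1 <= t <= T)%N -> P.-integrable setT (EFin \o f t)) ->
  P.-integrable setT (EFin \o (fun w => f (tau w) w)).
Proof.
move=> fi; rewrite stoppedE; apply: integrable_sum => // i _.
exact: integrable_piece.
Qed.

Lemma integral_stopped f :
  (forall t, (1 <= t <= T)%N -> P.-integrable setT (EFin \o f t)) ->
  (\int[P]_w (f (tau w) w)%:E =
   \sum_(i < T) \int[P]_(w in [set w | tau w = i.+1]) (f i.+1 w)%:E)%E.
Proof.
move=> fi; rewrite -[LHS]/(\int[P]_w (EFin \o (fun w => f (tau w) w)) w)%E.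
rewrite stoppedE integral_sum//; last by move=> i; exact: integrable_piece.
by apply: eq_bigr => i _; rewrite -integral_mkcond.
Qed.

End stopped.

(** * Filtrations and stopping times *)

(** Contained in the ambient sigma-algebra up to the horizon only: a process is
    unconstrained at later times. *)
Definition is_filtration d (Omega : measurableType d) (T : nat)
    (F : nat -> set (set Omega)) :=
  [/\ forall t, sigma_algebra setT (F t),
      forall s t, (s <= t)%N -> F s `<=` F t &
      forall t, (t <= T)%N -> F t `<=` measurable].

Section filtration.
Context d (Omega : measurableType d) (R : realType) (P : probability Omega R).
Variables (T : nat) (F : nat -> set (set Omega)).
Hypothesis filtF : is_filtration T F.

Lemma stopping_time_eq tau t : stopping_time T F tau -> (1 <= t <= T)%N ->
  F t [set w | tau w = t].
Proof.
move=> [tauT tauF] tT; have [sF mF _] := filtF.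
have GE := measurable_sub_sigma_algebraE (sF t).
rewrite -GE (_ : mkset _ =
    [set w | (tau w <= t)%N] `\` [set w | (tau w <= t.-1)%N]); last first.
  apply/seteqP; split=> w /=.
    move=> ->; split=> //; apply/negP; rewrite -ltnNge prednK//.
    by case/andP: tT.
  move=> [tau1 /negP]; rewrite -ltnNge prednK; last by case/andP: tT.
  by move=> tau2; apply/eqP; rewrite eqn_leq tau1.
apply: measurableD; rewrite GE; first exact: tauF.
have [t1|t1] := leqP 1 t.-1.
  apply: (mF t.-1); first exact: leq_pred.
  by apply: tauF; rewrite t1/= (leq_trans (leq_pred _))//; case/andP: tT.
(* Now t = 1, and tau never takes the value 0. *)
rewrite (_ : mkset _ = set0); first by case: (sF t).
apply/seteqP; split=> w //= tau1.
by have /andP[] := tauT w; rewrite leqNgt (leq_ltn_trans tau1).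
Qed.

Lemma measurable_stopping_time tau t : stopping_time T F tau ->
  (1 <= t <= T)%N -> measurable [set w | tau w = t].
Proof.
move=> stau tT; have [_ _ Fm] := filtF.
by apply: (Fm t) => //; [case/andP: tT|exact: stopping_time_eq].
Qed.

(** Optional stopping for the closed martingale t |-> E[X | F_t], whose values
    C t are arbitrary versions: on the event tau = t, which belongs to F_t, the
    variables C t and X have the same integral. *)
Lemma integral_stopped_cond_exp tau X (C : nat -> Omega -> R) :
  stopping_time T F tau -> P.-integrable setT (EFin \o X) ->
  (forall t, (1 <= t <= T)%N -> is_cond_exp P (F t) X (C t)) ->
  (\int[P]_w (C (tau w) w)%:E = \int[P]_w (X w)%:E)%E.
Proof.
move=> stau iX CX; have tauT : forall w, (1 <= tau w <= T)%N by case: stau.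
have mtau t := @measurable_stopping_time tau t stau.
rewrite (integral_stopped tauT mtau (f := C)); last by move=> t /CX[].
rewrite (integral_stopped tauT mtau (f := fun=> X))//.
apply: eq_bigr => i _; have iT : (1 <= i.+1 <= T)%N := ltn_ord i.
by have [_ _] := CX _ iT; apply; apply: stopping_time_eq.
Qed.

(** The first t with A t, completed by the value T when there is none. *)
Lemma exists_hitting_time (A : nat -> set Omega) : (1 <= T)%N ->
  (forall t, (1 <= t <= T)%N -> F t (A t)) ->
  exists2 tau, stopping_time T F tau &
    forall w, (exists2 t, (1 <= t <= T)%N & A t w) -> A (tau w) w.
Proof.
move=> T1 FA; have [sF mF _] := filtF.
pose stop w t := (1 <= t <= T)%N && ((t == T) || `[< A t w >]).
have stopT w : exists t, stop w t by exists T; rewrite /stop T1 leqnn eqxx.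
pose tau w := ex_minn (stopT w).
have tauP w : stop w (tau w) by rewrite /tau; case: ex_minnP.
have tau_min w t : stop w t -> (tau w <= t)%N.
  by rewrite /tau; case: ex_minnP => s _ smin; exact: smin.
exists tau; first split=> [w|t tT]; first by have /andP[] := tauP w.
  have GE := measurable_sub_sigma_algebraE (sF t).
  rewrite -GE (_ : mkset _ =
      \bigcup_(s in [set s | (s <= t)%N]) [set w | stop w s]).
    apply: bigcup_measurable => s /= st; rewrite GE; apply: (mF s) => //.
    have GsE := measurable_sub_sigma_algebraE (sF s).
    have [sT|sT] := boolP (1 <= s <= T)%N; last first.
      rewrite (_ : mkset _ = set0); first by case: (sF s).
      by apply/seteqP; split=> w //=; rewrite /stop (negbTE sT).
    have [sET|sNT] := eqVneq s T.
      rewrite (_ : mkset _ = setT); first by rewrite -GsE; exact: measurableT.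
      by apply/seteqP; split=> w //= _; rewrite /stop sT sET eqxx.
    rewrite (_ : mkset _ = A s); first exact: FA.
    by apply/seteqP; split=> w; rewrite /stop /= sT (negbTE sNT) /=;
      [move/asboolP | move=> ?; apply/asboolP].
  apply/seteqP; split=> w /=.
    by move=> taut; exists (tau w); last exact: tauP.
  by move=> [s st /tau_min taus]; exact: (leq_trans taus st).
move=> w [t tT At].
have /tau_min taut : stop w t.
  by rewrite /stop tT; apply/orP; right; exact/asboolP.
have /andP[_ /orP[/eqP tauT|/asboolP//]] := tauP w.
suff -> : tau w = t by [].
by apply/eqP; rewrite eqn_leq taut tauT; case/andP: tT.
Qed.

End filtration.

(** * Existence of a time at which the iterates reach zero *)

(** If every z n t stayed below a common -e < 0, the hypothesis on T with
    c = -e would raise z n T by e at each step, forcing it above 0. Since there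
    are finitely many times, a bound for each of them gives a common one. *)
Lemma exists_time_sup_ge0 (R : realType) (T : nat) (z : nat -> nat -> R) :
  (1 <= T)%N ->
  (forall n, z n T <= 0) ->
  (forall n (c : R), (forall t, (1 <= t <= T)%N -> z n t <= c) ->
     z n T - c <= z n.+1 T) ->
  exists2 t, (1 <= t <= T)%N & forall m, exists n, - m.+1%:R^-1 <= z n t.
Proof.
move=> T1 z0 zS; apply: contrapT => noT.
have bounded t : (1 <= t <= T)%N -> exists m, forall n, z n t < - m.+1%:R^-1.
  move=> tT; apply: contrapT => nobound; apply: noT; exists t => // m.
  apply: contrapT => zm; apply: nobound; exists m => n.
  by rewrite ltNge; apply/negP => zn; apply: zm; exists n.
have [e e0 ze] : exists2 e : R, 0 < e &
    forall t, (1 <= t <= T)%N -> forall n, z n t <= - e.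
  suff : forall T', (T' <= T)%N -> exists2 e : R, 0 < e &
    forall t, (1 <= t <= T')%N -> forall n, z n t <= - e by exact.
  elim=> [_|T' IH T'T]; first by exists 1 => // -[].
  have [e e0 ze] := IH (ltnW T'T).
  have [m zm] := bounded T'.+1 T'T.
  exists (Num.min e m.+1%:R^-1).
    by rewrite lt_min e0 invr_gt0 ltr0Sn.
  move=> t; rewrite [(t <= _)%N]leq_eqVlt => /andP[t1 /orP[/eqP ->|tT'] n].
    by rewrite (le_trans (ltW (zm n)))// lerN2 ge_min lexx orbT.
  by rewrite (le_trans (ze t _ n)) ?t1// lerN2 ge_min lexx.
have zgrow n : z 0%N T + n%:R * e <= z n T.
  elim: n => [|n IH]; first by rewrite mul0r addr0.
  rewrite -natr1 mulrDl mul1r addrA (le_trans (lerD IH (lexx e)))//.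
  by rewrite -[e in X in X <= _]opprK zS// => t tT; exact: ze.
have := zgrow (Num.trunc (- z 0%N T / e)).+1.
apply/negP; rewrite -ltNge (le_lt_trans (z0 _))// -ltrBlDl sub0r.
by rewrite -ltr_pdivrMr// truncnS_gt.
Qed.

(** * The expansion of the optimal value *)

Section expansion.
Context d (Omega : measurableType d) (R : realType) (P : probability Omega R).
Variables (T : nat) (F : nat -> set (set Omega)).
Variables (Z : nat -> Omega -> R) (Zs : nat -> nat -> Omega -> R).
Hypothesis T1 : (1 <= T)%N.
Hypothesis filtF : is_filtration T F.
Hypothesis adapted : forall t, (1 <= t <= T)%N -> measurable_wrt (F t) (Z t).
Hypothesis integrableZ :
  forall t, (1 <= t <= T)%N -> P.-integrable setT (EFin \o Z t).
Hypothesis itZ : iterated_process P T F Z Zs.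

Let TT : (1 <= T <= T)%N. Proof. by rewrite T1 leqnn. Qed.
Let sF t : sigma_algebra setT (F t). Proof. by case: filtF. Qed.
Let mF t : (1 <= t <= T)%N -> F t `<=` measurable.
Proof. by case: filtF => _ _ h /andP[_]; exact: h. Qed.

Lemma iterated_cond_exp k t : (1 <= k)%N -> (1 <= t <= T)%N ->
  is_cond_exp P (F t) (path_max T (Zs k)) (Zs k t \- Zs k.+1 t).
Proof.
move=> k1 tT; have [C condC ->] := itZ.2 k t k1 tT.
rewrite [X in is_cond_exp _ _ _ X](_ : _ = C)//.
by apply/funext => w /=; rewrite opprB addrC subrK.
Qed.

Lemma iterated_adapted_integrable k t : (1 <= k)%N -> (1 <= t <= T)%N ->
  measurable_wrt (F t) (Zs k t) /\ P.-integrable setT (EFin \o Zs k t).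
Proof.
move=> + tT; elim: k => // -[|k] IH _.
  by rewrite itZ.1//; split; [exact: adapted|exact: integrableZ].
have [mZ iZ] := IH isT.
have [C [mC iC _] ->] := itZ.2 k.+1 t isT tT.
split; first exact: measurable_wrtB.
exact: (integrableB measurableT iZ iC).
Qed.

Lemma integrable_iterated_max k : (1 <= k)%N ->
  P.-integrable setT (EFin \o path_max T (Zs k)).
Proof.
move=> k1.
apply: (path_max_closed (K := fun U => P.-integrable setT (EFin \o U))) =>
  // [U V|t tT]; first exact: integrable_maxr.
by have [] := iterated_adapted_integrable k1 tT.
Qed.

Lemma measurable_iterated_max k : (1 <= k)%N ->
  measurable_wrt (F T) (path_max T (Zs k)).
Proof.
move=> k1.
apply: (path_max_closed (K := measurable_wrt (F T))) => // [U V|t tT].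
  exact: measurable_wrt_max.
have [_ FF _] := filtF; have [mZ _] := iterated_adapted_integrable k1 tT.
by move=> B mB; apply: (FF t); [case/andP: tT|exact: mZ].
Qed.

(** The path maximum dominates the adapted variable Z^k_t, hence so does its
    conditional expectation. *)
Lemma ae_iterated_le0 k t : (1 <= t <= T)%N ->
  {ae P, forall w, Zs k.+2 t w <= 0}.
Proof.
move=> tT; have [mZ iZ] := @iterated_adapted_integrable k.+1 t isT tT.
apply: filterS (cond_exp_ge (sF t) (mF tT) (@iterated_cond_exp k.+1 t isT tT)
  (@integrable_iterated_max k.+1 isT) mZ iZ _); last first.
  by apply: aeW => w; exact: path_max_ge.
by move=> w /=; rewrite lerBrDl gerDr.
Qed.

Lemma ae_range (Q : nat -> Omega -> Prop) :
  (forall t, (1 <= t <= T)%N -> {ae P, forall w, Q t w}) ->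
  {ae P, forall w, forall t, (1 <= t <= T)%N -> Q t w}.
Proof.
move=> aeQ; apply: ae_foralln => t.
have [tT|_] := boolP (1 <= t <= T)%N; last exact: aeW.
by apply: filterS (aeQ t tT).
Qed.

(** From the second process on the path maximum is nonpositive, so its
    conditional expectation is subtracted with a favourable sign. *)
Lemma ae_iterated_le k t : (1 <= t <= T)%N ->
  {ae P, forall w, Zs k.+2 t w <= Zs k.+3 t w}.
Proof.
move=> tT.
have M0 : {ae P, forall w, path_max T (Zs k.+2) w <= cst 0 w}.
  apply: filterS (ae_range (ae_iterated_le0 k)) => w Z0.
  exact: path_max_le.
have m0 : measurable_wrt (F t) (cst 0 : Omega -> R).
  by apply/measurable_wrtE.
have i0 : P.-integrable setT (EFin \o (cst 0 : Omega -> R)).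
  exact: integrable0.
apply: filterS (cond_exp_le (sF t) (mF tT) (@iterated_cond_exp k.+2 t isT tT)
  (@integrable_iterated_max k.+2 isT) m0 i0 M0) => w /=.
by rewrite subr_le0.
Qed.

(** At time T the path maximum is known, so conditioning does not change it. *)
Lemma ae_iterated_last k :
  {ae P, forall w, Zs k.+2 T w - path_max T (Zs k.+2) w <= Zs k.+3 T w}.
Proof.
have MM : {ae P, forall w, path_max T (Zs k.+2) w <= path_max T (Zs k.+2) w}.
  by apply: aeW.
apply: filterS (cond_exp_le (sF T) (mF TT) (@iterated_cond_exp k.+2 T isT TT)
  (@integrable_iterated_max k.+2 isT) (@measurable_iterated_max k.+2 isT)
  (@integrable_iterated_max k.+2 isT) MM) => w /=.
by rewrite !lerBlDr addrC.
Qed.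

(** The event sup_k Z^k_t >= 0 over k >= 2, written with countable operations;
    almost surely, the iterates being nonpositive and increasing in k, it is the
    event that Z^k_t converges to 0. *)
Definition reaches0 t : set Omega :=
  \bigcap_m \bigcup_n [set w | - m.+1%:R^-1 <= Zs n.+2 t w].

Lemma reaches0_adapted t : (1 <= t <= T)%N -> F t (reaches0 t).
Proof.
move=> tT; have GE := measurable_sub_sigma_algebraE (sF t).
rewrite -GE; apply: bigcap_measurable => // m _.
apply: bigcup_measurable => n _.
rewrite GE (_ : mkset _ = Zs n.+2 t @^-1` `[- m.+1%:R^-1, +oo[); last first.
  by apply/seteqP; split=> w /=; rewrite in_itv/= andbT.
by have [mZ _] := @iterated_adapted_integrable n.+2 t isT tT; exact: mZ.
Qed.

Lemma ae_iterated_regular : {ae P, forall w, forall t, (1 <= t <= T)%N ->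
  forall n, Zs n.+2 t w <= 0 /\ Zs n.+2 t w <= Zs n.+3 t w}.
Proof.
apply: ae_range => t tT; apply: ae_foralln => n.
apply: filterS2 (ae_iterated_le0 n tT) (ae_iterated_le n tT) => w; exact: conj.
Qed.

Lemma ae_exists_reaches0 :
  {ae P, forall w, exists2 t, (1 <= t <= T)%N & reaches0 t w}.
Proof.
apply: filterS2 ae_iterated_regular (ae_foralln ae_iterated_last) => w Zreg ZT.
have [|n c Zc|t tT Zt] := @exists_time_sup_ge0 R T (fun n t => Zs n.+2 t w) T1.
- by move=> n; have [] := Zreg T TT n.
- rewrite (le_trans _ (ZT n))// lerD2l lerN2; exact: path_max_le.
- by exists t => // m _; have [n Zn] := Zt m; exists n.
Qed.

Lemma integrable_stopped_iterated tau k : stopping_time T F tau -> (1 <= k)%N ->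
  P.-integrable setT (EFin \o (fun w => Zs k (tau w) w)).
Proof.
move=> stau k1; apply: (integrable_stopped (T := T)) => [|t|t] tT.
- by case: stau.
- exact: measurable_stopping_time stau tT.
- by have [] := iterated_adapted_integrable k1 tT.
Qed.

(** Optional stopping gives E[Z^k_tau] = E[M_k] + E[Z^{k+1}_tau] with M_k the
    path maximum of Z^k; iterate. *)
Lemma expectation_stopped_expansion tau n : stopping_time T F tau ->
  ('E_P[fun w => Zs 1%N (tau w) w] =
   \sum_(1 <= k < n.+1) 'E_P[path_max T (Zs k)]
   + 'E_P[fun w => Zs n.+1 (tau w) w])%E.
Proof.
move=> stau; elim: n => [|n ->]; first by rewrite big_geq// add0e.
rewrite [in RHS]big_nat_recr//= -addeA; congr (_ + _)%E.
have tauT : forall w, (1 <= tau w <= T)%N by case: stau.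
have mtau t := @measurable_stopping_time _ _ _ _ filtF tau t stau.
rewrite unlock.
rewrite -(integral_stopped_cond_exp filtF stau
  (@integrable_iterated_max n.+1 isT)
  (fun t => @iterated_cond_exp n.+1 t isT)).
rewrite -integralD_EFin//; last 2 first.
- apply: (integrable_stopped tauT mtau
    (f := fun t => Zs n.+1 t \- Zs n.+2 t)) => t tT.
  by have [] := @iterated_cond_exp n.+1 t isT tT.
- exact: integrable_stopped_iterated.
by apply: eq_integral => w _ /=; rewrite -EFinD subrK.
Qed.

Lemma expectation_stopped_iterated_le tau n : stopping_time T F tau ->
  ('E_P[fun w => Zs 1%N (tau w) w] <=
   \sum_(1 <= k < n.+2) 'E_P[path_max T (Zs k)])%E.
Proof.
move=> stau; rewrite (expectation_stopped_expansion n.+1 stau).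
rewrite -[leRHS]adde0 leeD2l// unlock.
have i0 : P.-integrable setT (EFin \o (cst 0 : Omega -> R)).
  exact: integrable0.
have := @ae_le_integral _ _ _ P setT _ _ measurableT
  (@integrable_stopped_iterated tau n.+2 stau isT) i0.
rewrite [X in (_ <= X)%E]integral0; apply.
apply: filterS (ae_iterated_regular) => w Zreg.
by have [] := Zreg (tau w) (stau.1 w) n.
Qed.

(** Stop at the first time at which the iterates reach 0: almost surely there is
    one, and |Z^2_tau| dominates the increasing nonpositive sequence
    Z^n_tau, n >= 2. *)
Lemma exists_optimal_stopping_time :
  exists2 tau, stopping_time T F tau &
    (fun n => 'E_P[fun w => Zs n.+2 (tau w) w])%E @ \oo --> 0%E.
Proof.
have [tau stau tauA] := exists_hitting_time filtF T1 reaches0_adapted.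
exists tau => //; have tauT := stau.1.
have iZ k := @integrable_stopped_iterated tau k.+1 stau isT.
have cvg0 : {ae P, forall w, setT w ->
    (fun n => (EFin \o (fun w => Zs n.+2 (tau w) w)) w) @ \oo
      --> (cst 0%E w : \bar R)}.
  apply: filterS2 ae_iterated_regular ae_exists_reaches0 => w Zreg /tauA wA _.
  have {}Zreg := Zreg (tau w) (tauT w).
  have Zmono := homo_leq (f := fun n => Zs n.+2 (tau w) w) lexx le_trans
    (fun n => (Zreg n).2).
  apply/fine_cvgP; split; first exact: nearW.
  apply/cvgrPdist_le => e e0.
  have [m _ me] : \forall m \near \oo, m.+1%:R^-1 <= e.
    by near=> m; apply/ltW; near: m; exact: near_infty_natSinv_lt (PosNum e0).
  have [N _ ZN] := wA m I.
  exists N => // n /= Nn.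
  rewrite sub0r normrN ler0_norm; last exact: (Zreg n).1.
  rewrite lerNl (le_trans _ (_ : Zs N.+2 (tau w) w <= _))//.
    by rewrite (le_trans _ ZN)// lerN2; exact: (me m (leqnn m)).
  exact: Zmono.
have dom : {ae P, forall w, forall n, setT w ->
    (`|(EFin \o (fun w => Zs n.+2 (tau w) w)) w| <=
     (EFin \o (fun w => `|Zs 2%N (tau w) w|%R)) w)%E}.
  apply: filterS ae_iterated_regular => w /(_ _ (tauT w)) Zreg n _ /=.
  have Zmono := homo_leq (f := fun n => Zs n.+2 (tau w) w) lexx le_trans
    (fun n => (Zreg n).2).
  rewrite lee_fin !ler0_norm ?lerN2; [|exact: (Zreg 0%N).1|exact: (Zreg n).1].
  exact: Zmono.
have mZ n := measurable_int P (iZ n.+1).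
have [_ _] := dominated_convergence measurableT mZ (measurable_cst _) cvg0
  (integrable_norm (iZ 1%N)) dom.
rewrite integral0 => cvgZ.
by under eq_fun do rewrite unlock.
Unshelve. all: by end_near.
Qed.

Lemma opt_value_iterated :
  opt_value P T F Z = ereal_sup
    [set ('E_P[fun w => Zs 1%N (tau w) w])%E | tau in stopping_time T F].
Proof.
rewrite /opt_value; congr ereal_sup; apply/seteqP; split=> _ [tau stau <-];
  exists tau => //; congr expectation; apply/funext => w;
  by rewrite itZ.1//; exact: stau.1.
Qed.

(** The stopping time at which the remainder vanishes has the limit of the
    partial sums as expected reward; it is optimal since no expected reward
    exceeds a partial sum of positive length. *)
Theorem cvg_opt_value :
  (fun n : nat => \sum_(1 <= k < n.+1) 'E_P[path_max T (Zs k)])%E @ \oo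
    --> opt_value P T F Z.
Proof.
have [tau stau tau0] := exists_optimal_stopping_time.
pose S n := (\sum_(1 <= k < n.+1) 'E_P[path_max T (Zs k)])%E.
have S_cvg : S n @[n --> \oo] --> ('E_P[fun w => Zs 1%N (tau w) w])%E.
  rewrite -cvg_shiftS /=.
  have fin k : ('E_P[fun w => Zs k.+1 (tau w) w])%E \is a fin_num.
    by rewrite unlock integrable_fin_num//; exact: integrable_stopped_iterated.
  have : ('E_P[fun w => Zs 1%N (tau w) w] - 'E_P[fun w => Zs n.+2 (tau w) w])%E
      @[n --> \oo] --> ('E_P[fun w => Zs 1%N (tau w) w] - 0)%E.
    by apply: cvgeB => //; [rewrite fin_num_adde_defl|exact: cvg_cst].
  rewrite sube0 (_ : (fun n => _) = (fun n => S n.+1))//.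
  by apply/funext => n; rewrite (expectation_stopped_expansion n.+1 stau) addeK.
suff -> : opt_value P T F Z = ('E_P[fun w => Zs 1%N (tau w) w])%E by [].
rewrite opt_value_iterated; apply/eqP; rewrite eq_le; apply/andP; split.
  apply: ge_ereal_sup => _ [tau' stau' <-].
  have S_shift : S n.+1 @[n --> \oo] --> ('E_P[fun w => Zs 1%N (tau w) w])%E.
    by rewrite cvg_shiftS.
  rewrite -(cvg_lim _ S_shift)//; apply: lime_ge.
    by apply/cvg_ex; eexists; exact: S_shift.
  by apply: nearW => n; exact: expectation_stopped_iterated_le.
by apply: ereal_sup_ubound; exists tau.
Qed.

End expansion.

(** * The natural filtration *)

Section natural_filtration.
Context d d' (Omega : measurableType d) (E : measurableType d').
Variable Y : nat -> Omega -> E.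

Lemma natural_filtration_smallest t (G : set (set Omega)) :
  sigma_algebra setT G ->
  (forall i B, (i < t)%N -> measurable B -> G (Y i.+1 @^-1` B)) ->
  natural_filtration Y t `<=` G.
Proof.
move=> sG YG; apply: smallest_sub => // A.
by rewrite -bigcup_seq => -[i _ [B mB <-]]; rewrite setTI; exact: YG.
Qed.

Lemma natural_filtration_preimage t i B : (i < t)%N -> measurable B ->
  natural_filtration Y t (Y i.+1 @^-1` B).
Proof.
move=> it mB; apply: sub_sigma_algebra; rewrite -bigcup_seq.
by exists (Ordinal it); [rewrite /= mem_index_enum|exists B; rewrite ?setTI].
Qed.

Lemma natural_filtrationP T :
  (forall t, (1 <= t <= T)%N -> measurable_fun setT (Y t)) ->
  is_filtration T (natural_filtration Y).
Proof.
move=> mY; split=> [t|s t st|t tT]; first exact: smallest_sigma_algebra.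
- apply: natural_filtration_smallest; first exact: smallest_sigma_algebra.
  by move=> i B /leq_trans/(_ st); exact: natural_filtration_preimage.
- apply: natural_filtration_smallest; first exact: sigma_algebra_measurable.
  move=> i B it mB; rewrite -[X in measurable X]setTI.
  by apply: mY => //=; exact: leq_trans it tT.
Qed.

Lemma measurable_history t :
  measurable_fun (setT : set (g_sigma_algebraType (natural_filtration Y t)))
    (history Y t : _ -> t.-tuple E).
Proof.
apply/measurable_fun_tnthP => i.
rewrite (_ : _ \o _ = Y i.+1).
  move=> _ B mB; rewrite setTI; apply: sub_sigma_algebra.
  exact: natural_filtration_preimage.
by apply/funext => w /=; rewrite tnth_mktuple.
Qed.

End natural_filtration.

Theorem theorem1 (R : realType) (d : measure_display) (Omega : measurableType d)
    (P : probability Omega R) (T D : nat)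
    (Y : nat -> Omega -> D.-tuple R)
    (g : forall t : nat, t.-tuple (D.-tuple R) -> R)
    (Zs : nat -> nat -> Omega -> R) :
  let F := natural_filtration Y in
  let Z := fun (t : nat) (w : Omega) => g t (history Y t w) in
  let OPT := opt_value P T F Z in
  (1 <= T)%N -> (1 <= D)%N ->
  (forall t, (1 <= t <= T)%N -> measurable_fun [set: Omega] (Y t)) ->
  (forall t, (1 <= t <= T)%N ->
     measurable_fun [set: t.-tuple (D.-tuple R)] (g t)) ->
  (forall t, (1 <= t <= T)%N -> P.-integrable [set: Omega] (EFin \o Z t)) ->
  (forall t, (1 <= t <= T)%N -> forall w, 0 <= Z t w) ->
  (0 < OPT)%E ->
  iterated_process P T F Z Zs ->
  (fun n : nat => \sum_(1 <= k < n.+1) 'E_P[path_max T (Zs k)])%E @ \oo --> OPT.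
Proof.
move=> F Z OPT T1 _ mY mg iZ _ _ itZ.
have filtF : is_filtration T F by exact: natural_filtrationP.
apply: cvg_opt_value iZ itZ => // t tT.
apply/measurable_wrtE; first by case: filtF.
exact: (measurableT_comp (mg t tT) (@measurable_history _ _ _ _ Y t)).
Qed.
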